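(* Let $\mathbb{k}$ be a field and $n\ge2$. The metric space $(\mathbf{X}_n,d_{\mathbf{X}})$ is complete.
   Context: $\mathrm{Aut}(\mathbb{k}^n)$ is the group (under composition) of polynomial automorphisms $g=(g_1,\dots,g_n)$, $g_i\in\mathbb{k}[x_1,\dots,x_n]$, of affine $n$-space. $\mathrm{Tame}(\mathbb{k}^n)$ is the subgroup generated by $\mathrm{GL}_n(\mathbb{k})$ and the elementary automorphisms $(x_1,\dots,x_n)\mapsto(x_1+P(x_2,\dots,x_n),x_2,\dots,x_n)$. For $g\in\mathrm{Aut}(\mathbb{k}^n)$ and a polynomial $P$, $g^*P:=P(g_1,\dots,g_n)$; the group acts on the left on valuations $\nu:\mathbb{k}[x_1,\dots,x_n]\to\mathbb{R}\cup\{+\infty\}$ by $(g\cdot\nu)(P)=\nu(g^*P)$, and hence on classes of valuations modulo multiplication by positive reals. Let $\Pi=\{\alpha\in\mathbb{R}^n:\alpha_i>0\ \forall i\}$ and $\Pi^+=\{\alpha\in\Pi:\alpha_1\ge\dots\ge\alpha_n\}$; let $[\alpha]$ be the class of $\alpha$ modulo positive scaling, and let $\nabla$, $\nabla^+$ be the sets of classes of $\Pi$, $\Pi^+$. For $\alpha\in\Pi$ set $\nu_{\mathrm{id},\alpha}\big(\sum_I c_Ix_1^{i_1}\cdots x_n^{i_n}\big)=\min_{I:\,c_I\ne0}\big(-\sum_k\alpha_ki_k\big)$ (and $+\infty$ for the zero polynomial), and $\nu_{f,\alpha}=f\cdot\nu_{\mathrm{id},\alpha}$ for $f\in\mathrm{Tame}(\mathbb{k}^n)$;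 the class of $\nu_{f,\alpha}$ modulo positive scaling depends only on $[\alpha]$ and is denoted $\nu_{f,[\alpha]}$. $\mathbf{X}_n=\{\nu_{f,[\alpha]}: f\in\mathrm{Tame}(\mathbb{k}^n),[\alpha]\in\nabla\}$. The chamber of $f$ is $\mathbf{E}^+_f=\{\nu_{f,[\alpha]}:[\alpha]\in\nabla^+\}$; the chambers cover $\mathbf{X}_n$ and $[\alpha]\mapsto\nu_{f,[\alpha]}$ is a bijection $\nabla^+\to\mathbf{E}_f^+$. Distance: represent each $[\alpha]\in\nabla$ by the representative with $\prod\alpha_i=1$ and put $\beta_i=\log\alpha_i$; this identifies $\nabla$ with $\{\beta\in\mathbb{R}^n:\sum\beta_i=0\}\cong\mathbb{R}^{n-1}$, and $|\cdot,\cdot|$ is the induced Euclidean distance on $\nabla\supset\nabla^+$. Transport it to each chamber $\mathbf{E}_f^+$ via $[\alpha]\mapsto\nu_{f,[\alpha]}$. For $x,y\in\mathbf{X}_n$, $d_{\mathbf{X}}(x,y)$ is the infimum of $\sum_{i=0}^{k-1}|y_i,y_{i+1}|$ over all $k$ and all finite sequences $x=y_0,y_1,\dots,y_k=y$ in $\mathbf{X}_n$ together with $f_0,\dots,f_{k-1}\in\mathrm{Tame}(\mathbb{k}^n)$ such that $y_i,y_{i+1}\in\mathbf{E}^+_{f_i}$, the distance $|y_i,y_{i+1}|$ being measured in $\mathbf{E}^+_{f_i}$. This $d_{\mathbf{X}}$ is a distance on $\mathbf{X}_n$. *)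

(* Defs.v *)
From HB Require Import structures.
From mathcomp Require Import all_boot all_order all_algebra.
(* The notations of mpoly clash with those of MathComp-Analysis. *)
From mathcomp Require Export -(notations) mpoly.
From mathcomp Require Import all_classical all_reals all_analysis.

Set Implicit Arguments.
Unset Strict Implicit.
Unset Printing Implicit Defensive.

Import Order.TTheory GRing.Theory Num.Theory.

Local Open Scope classical_set_scope.
Local Open Scope ring_scope.

(** Polynomial self-maps of affine space *)

Section TameGroup.
Variables (k : fieldType) (n : nat).

(* [mpoly n k] is the polynomial ring k[x_0, ..., x_(n-1)];
   [g : polymap] is the map (g_0, ..., g_(n-1)). *)
Definition polymap := n.-tuple (mpoly n k).

Definition polyvar (i : 'I_n) : mpoly n k := mpolyX k (mnm1 i).

Definition polymap_id : polymap := [tuple polyvar i | i < n].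

(* g^* P = P(g_0, ..., g_(n-1)) *)
Definition pullback (g : polymap) (P : mpoly n k) : mpoly n k :=
  comp_mpoly g P.

Definition polymap_comp (g h : polymap) : polymap :=
  [tuple pullback h (tnth g i) | i < n].

Definition linear_polymap (A : 'M[k]_n) : polymap :=
  [tuple \sum_(j < n) A i j *: polyvar j | i < n].

(* P involves only the variables of index > 0. *)
Definition free_of_first (P : mpoly n k) : Prop :=
  forall m, m \in msupp P -> forall i : 'I_n, val i = 0%N -> m i = 0%N.

(* Only the coordinate of index 0 is changed. *)
Definition elementary_polymap (P : mpoly n k) : polymap :=
  [tuple if val i == 0%N then polyvar i + P else polyvar i | i < n].

(* The subgroup generated by the linear and the elementary automorphisms. *)
Inductive tame : polymap -> Prop :=
| tame_id : tame polymap_id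
| tame_linear (A : 'M[k]_n) : A \in unitmx -> tame (linear_polymap A)
| tame_elementary (P : mpoly n k) :
    free_of_first P -> tame (elementary_polymap P)
| tame_comp (g h : polymap) : tame g -> tame h -> tame (polymap_comp g h)
| tame_inv (g h : polymap) : tame g ->
    polymap_comp g h = polymap_id -> polymap_comp h g = polymap_id -> tame h.

End TameGroup.

(** Weights *)

Section Weights.
Variables (R : realType) (n : nat).

Definition weight_cone : set 'rV[R]_n :=
  [set a | forall i, 0 < a 0 i].

Definition weight_chamber : set 'rV[R]_n :=
  [set a | weight_cone a /\ forall i j : 'I_n, (i <= j)%N -> a 0 j <= a 0 i].

(* The positive multiple of [a] whose coordinates have product 1. *)
Definition normalized_weight (a : 'rV[R]_n) : 'rV[R]_n :=
  ((\prod_i a 0 i) `^ (n%:R^-1))^-1 *: a.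

Definition log_weight (a : 'rV[R]_n) : 'rV[R]_n :=
  \row_i ln (normalized_weight a 0 i).

(* The Euclidean norm is spelled out because the norm of the normed module
   ['rV[R]_n] is the sup norm. *)
Definition weight_dist (a b : 'rV[R]_n) : R :=
  Num.sqrt (\sum_i (log_weight a 0 i - log_weight b 0 i) ^+ 2).

End Weights.

(** Valuations, the space X_n and its chambers *)

Section Space.
Variables (R : realType) (k : fieldType) (n : nat).

Definition valuation_fun := mpoly n k -> \bar R.

Definition nu_id (a : 'rV[R]_n) : valuation_fun := fun P =>
  \big[Order.min/+oo%E]_(m <- msupp P) (- \sum_i a 0 i * (m i)%:R)%:E.

Definition nu (f : polymap k n) (a : 'rV[R]_n) : valuation_fun :=
  fun P => nu_id a (pullback f P).

(* The class of a valuation modulo positive scaling, as a set of functions. *)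
Definition scaling_class (v : valuation_fun) : set valuation_fun :=
  [set w | exists2 t : R, 0 < t & forall P, w P = (t%:E * v P)%E].

Definition nu_class (f : polymap k n) (a : 'rV[R]_n) : set valuation_fun :=
  scaling_class (nu f a).

Definition tame_valuation_classes : set (set valuation_fun) :=
  [set x | exists f a, [/\ tame f, weight_cone a & x = nu_class f a]].

Definition tame_space : Type := set_type tame_valuation_classes.

HB.instance Definition _ := Choice.on tame_space.

Lemma tame_valuation_classes_base :
  nu_class (polymap_id k n) (const_mx 1) \in tame_valuation_classes.
Proof.
apply/mem_set; exists (polymap_id k n), (const_mx 1); split => //.
  exact: tame_id.
by move=> i; rewrite mxE.
Qed.

(* The library's notions of limit and completeness require a base point. *)
HB.instance Definition _ :=
  isPointed.Build tame_space (SigSub tame_valuation_classes_base).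

(* Both x and y lie in the chamber E^+_f, and |x, y| measured there is l.
   Since alpha |-> nu_(f, [alpha]) is injective on classes of weights, l is
   determined by f, x and y. *)
Definition chamber_dist (f : polymap k n) (x y : tame_space) (l : R) : Prop :=
  exists a b : 'rV[R]_n,
    [/\ weight_chamber a, weight_chamber b,
        val x = nu_class f a, val y = nu_class f b & l = weight_dist a b].

Definition chain_lengths (x y : tame_space) : set R :=
  [set L | exists (m : nat) (z : nat -> tame_space) (f : nat -> polymap k n)
                  (l : nat -> R),
    [/\ z 0%N = x, z m = y,
        forall i, (i < m)%N -> tame (f i) /\ chamber_dist (f i) (z i) (z i.+1) (l i)
      & L = \sum_(i < m) l i]].

(* Taken in [\bar R] so that the infimum is meaningful before knowing that any
   two points are joined by a chain. *)
Definition dX (x y : tame_space) : \bar R :=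
  ereal_inf [set L%:E | L in chain_lengths x y].

Definition dX_ball (x : tame_space) (e : R) : set tame_space :=
  [set y | (dX x y < e%:E)%E].

Lemma weight_distC (a b : 'rV[R]_n) : weight_dist a b = weight_dist b a.
Proof.
rewrite /weight_dist; congr Num.sqrt; apply: eq_bigr => i _.
by rewrite -sqrrN opprB.
Qed.

Lemma chamber_distC f x y l : chamber_dist f x y l -> chamber_dist f y x l.
Proof.
by move=> [a [b [Ha Hb xa yb ->]]]; exists b, a; split => //; rewrite weight_distC.
Qed.

Lemma chain_lengths0 x : chain_lengths x x 0.
Proof.
exists 0%N, (fun=> x), (fun=> polymap_id k n), (fun=> 0).
by split => //; rewrite big_ord0.
Qed.

Lemma chain_lengthsC x y L : chain_lengths x y L -> chain_lengths y x L.
Proof.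
move=> [m [z [f [l [z0 zm H ->]]]]].
exists m, (fun i => z (m - i)%N), (fun i => f (m - i.+1)%N),
  (fun i => l (m - i.+1)%N); split.
- by rewrite subn0.
- by rewrite subnn.
- move=> i im; have im' : (m - i.+1 < m)%N by rewrite ltn_subrL (leq_ltn_trans _ im).
  have [tf /chamber_distC cd] := H _ im'; split => //.
  by rewrite subnSK // in cd.
- by rewrite (reindex_inj rev_ord_inj).
Qed.

Lemma chain_lengthsD x y z L M :
  chain_lengths x y L -> chain_lengths y z M -> chain_lengths x z (L + M).
Proof.
move=> [m [u [f [l [u0 um Hu ->]]]]] [p [v [g [r [v0 vp Hv ->]]]]].
pose glue T (s t : nat -> T) i := if (i < m)%N then s i else t (i - m)%N.
exists (m + p)%N, (glue _ u v), (glue _ f g), (glue _ l r); rewrite /glue; split.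
- by case: ifPn => // ; rewrite -leqNgt leqn0 => /eqP m0; rewrite m0 v0 -um m0 u0.
- by rewrite ltnNge leq_addr /= addKn.
- move=> i imp; have [im|mi] := ltnP i m; last first.
    rewrite ltnNge (leq_trans mi) //= subSn //; apply: Hv.
    by rewrite ltn_subLR.
  have [//|mi1] := ltnP i.+1 m; first by move=> _; exact: Hu.
  have e : i.+1 = m by apply/eqP; rewrite eqn_leq im mi1.
  by have := Hu _ im; rewrite e subnn v0 -um.
- rewrite big_split_ord /=; congr (_ + _); apply: eq_bigr => i _.
    by rewrite ltn_ord.
  by rewrite ltnNge leq_addr /= addKn.
Qed.

Lemma dX_ballP x e y :
  dX_ball x e y <-> exists2 L, chain_lengths x y L & L < e.
Proof.
split => [/ereal_inf_lt[_ [L xyL <-]]|[L xyL Le]].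
  by rewrite lte_fin => Le; exists L.
by apply: le_lt_trans (_ : L%:E < e%:E)%E => //; apply: ereal_inf_lbound; exists L.
Qed.

Lemma dX_ball_center x (e : R) : 0 < e -> dX_ball x e x.
Proof. by move=> e0; apply/dX_ballP; exists 0 => //; exact: chain_lengths0. Qed.

Lemma dX_ball_sym x y (e : R) : dX_ball x e y -> dX_ball y e x.
Proof.
by move=> /dX_ballP[L xyL Le]; apply/dX_ballP; exists L => //; exact: chain_lengthsC.
Qed.

Lemma dX_ball_triangle x y z (e1 e2 : R) :
  dX_ball x e1 y -> dX_ball y e2 z -> dX_ball x (e1 + e2) z.
Proof.
move=> /dX_ballP[L xyL Le] /dX_ballP[M yzM Me]; apply/dX_ballP.
by exists (L + M); [exact: chain_lengthsD yzM|exact: ltrD].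
Qed.

(* The uniform structure and topology of [tame_space] are those of [dX]. *)
HB.instance Definition _ := hasNbhs.Build tame_space (nbhs_ (entourage_ dX_ball)).

HB.instance Definition _ := @Nbhs_isPseudoMetric.Build R tame_space
  (entourage_ dX_ball) erefl dX_ball
  dX_ball_center dX_ball_sym dX_ball_triangle erefl.

End Space.

(* Main.v *)
Require Import Defs.
From mathcomp Require Import all_boot all_order all_algebra perm.
From mathcomp Require Import all_classical all_reals all_analysis.
From mathcomp Require Import ring lra.

Set Implicit Arguments.
Unset Strict Implicit.
Unset Printing Implicit Defensive.

Import Order.TTheory GRing.Theory Num.Theory numFieldNormedType.Exports.

Local Open Scope classical_set_scope.
Local Open Scope ring_scope.

(** Sending nu_(f, [a]) with [a] in the model chamber to [a] is a well-defined
1-Lipschitz retraction of X_n onto the model chamber, which is complete; so the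
retraction of a Cauchy filter converges to some weight c.  If a is close enough
to c, then every polynomial automorphism fixing nu_(id, a) fixes nu_(id, c): only
finitely many monomials m can satisfy an inequality sum_j m_j a_j <= a_i with a
near c, and each of these inequalities is closed in a.  Along a short chain whose
retraction stays near c the points nu_(f_i, c) therefore all coincide, and this
common point is the limit. *)

(** * Composition and inversion of polynomial maps, and the Jacobian matrix at 0 *)

Section PolymapAlgebra.
Variables (k : fieldType) (n : nat).
Implicit Types (f g h : polymap k n) (P Q : mpoly n k).

Lemma mpoly_subring_ind (S : mpoly n k -> Prop) :
  S 0 -> S 1 -> (forall i, S (polyvar k i)) ->
  (forall c P, S P -> S (c *: P)) ->
  (forall P Q, S P -> S Q -> S (P + Q)) ->
  (forall P Q, S P -> S Q -> S (P * Q)) -> forall P, S P.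
Proof.
move=> S0 S1 SX SZ SD SM; elim/mpolyind => // c m P _ _ SP.
apply: SD => //; apply: SZ; rewrite mpolyXE_id.
apply: big_ind => // i _; elim: (m i) => [|e IH]; first by rewrite expr0.
by rewrite exprS; exact: SM (SX i) IH.
Qed.

Lemma pullback1 f : pullback f 1 = 1.
Proof. exact: comp_mpoly1. Qed.

Lemma pullbackM f P Q : pullback f (P * Q) = pullback f P * pullback f Q.
Proof. exact: (rmorphM (comp_mpoly f)). Qed.

Lemma pullbackD f P Q : pullback f (P + Q) = pullback f P + pullback f Q.
Proof. exact: comp_mpolyD. Qed.

Lemma pullbackZ f c P : pullback f (c *: P) = c *: pullback f P.
Proof. exact: comp_mpolyZ. Qed.

Lemma pullback0 f : pullback f 0 = 0.
Proof. exact: comp_mpoly0. Qed.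

Lemma pullback_polyvar f i : pullback f (polyvar k i) = tnth f i.
Proof. by rewrite /pullback comp_mpolyXU -tnth_nth. Qed.

Lemma pullback_id P : pullback (polymap_id k n) P = P.
Proof. exact: comp_mpoly_id. Qed.

Lemma pullback_comp f g P :
  pullback g (pullback f P) = pullback (polymap_comp f g) P.
Proof.
elim/mpoly_subring_ind: P => [||i|c P IH|P Q IP IQ|P Q IP IQ].
- by rewrite !pullback0.
- by rewrite !pullback1.
- by rewrite !pullback_polyvar tnth_mktuple.
- by rewrite !pullbackZ IH.
- by rewrite !pullbackD IP IQ.
- by rewrite !pullbackM IP IQ.
Qed.

Lemma polymap_compA f g h :
  polymap_comp f (polymap_comp g h) = polymap_comp (polymap_comp f g) h.
Proof. by apply: eq_from_tnth => i; rewrite !tnth_mktuple pullback_comp. Qed.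

Lemma polymap_1comp f : polymap_comp (polymap_id k n) f = f.
Proof.
by apply: eq_from_tnth => i; rewrite !tnth_mktuple pullback_polyvar.
Qed.

Definition polymap_inverse f g :=
  polymap_comp f g = polymap_id k n /\ polymap_comp g f = polymap_id k n.

Lemma polymap_inverse_sym f g : polymap_inverse f g -> polymap_inverse g f.
Proof. by case. Qed.

Lemma polymap_inverse_comp f g f' g' : polymap_inverse f f' ->
  polymap_inverse g g' ->
  polymap_inverse (polymap_comp f g) (polymap_comp g' f').
Proof.
move=> [ff' f'f] [gg' g'g]; split.
  by rewrite -polymap_compA (polymap_compA g) gg' polymap_1comp.
by rewrite -polymap_compA (polymap_compA f') f'f polymap_1comp.
Qed.

Lemma pullbackK f g P : polymap_inverse f g -> pullback g (pullback f P) = P.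
Proof. by move=> [fg _]; rewrite pullback_comp fg pullback_id. Qed.

Lemma linear_polymap_comp (A B : 'M[k]_n) :
  polymap_comp (linear_polymap A) (linear_polymap B) = linear_polymap (A *m B).
Proof.
apply: eq_from_tnth => i; rewrite !tnth_mktuple.
rewrite /pullback raddf_sum /=.
under eq_bigr do rewrite -/(pullback _ _) pullbackZ pullback_polyvar tnth_mktuple scaler_sumr.
rewrite exchange_big; apply: eq_bigr => j _ /=.
by rewrite mxE scaler_suml; apply: eq_bigr => l _; rewrite scalerA.
Qed.

Lemma linear_polymap1 : linear_polymap (1%:M : 'M[k]_n) = polymap_id k n.
Proof.
apply: eq_from_tnth => i; rewrite !tnth_mktuple (bigD1 i) //= mxE eqxx scale1r.
by rewrite big1 ?addr0 // => j ji; rewrite mxE eq_sym (negbTE ji) scale0r.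
Qed.

Lemma pullback_free_of_first f P : free_of_first P ->
  (forall i : 'I_n, val i != 0%N -> tnth f i = polyvar k i) -> pullback f P = P.
Proof.
move=> Pfree fE; rewrite /pullback comp_mpolyEX [RHS]mpolyE.
apply: eq_big_seq => m mP; congr (_ *: _).
rewrite comp_mpolyX [RHS]mpolyXE_id; apply: eq_bigr => i _.
have [i0|i0] := eqVneq (val i) 0%N; first by rewrite (Pfree m mP i i0) !expr0.
by rewrite fE.
Qed.

Lemma elementary_polymap_comp P Q : free_of_first P ->
  polymap_comp (elementary_polymap P) (elementary_polymap Q) =
  elementary_polymap (Q + P).
Proof.
move=> Pfree; apply: eq_from_tnth => i; rewrite !tnth_mktuple.
case: ifP => i0; last by rewrite pullback_polyvar tnth_mktuple i0.
rewrite pullbackD pullback_polyvar tnth_mktuple i0 addrA; congr (_ + _).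
by apply: pullback_free_of_first => // j /negbTE j0; rewrite tnth_mktuple j0.
Qed.

Lemma elementary_polymap0 : elementary_polymap (0 : mpoly n k) = polymap_id k n.
Proof.
by apply: eq_from_tnth => i; rewrite !tnth_mktuple addr0 if_same.
Qed.

Lemma tame_inverse f : tame f -> exists g, polymap_inverse f g.
Proof.
elim=> {f} [|A Au|P Pfree|f g _ [f' ff'] _ [g' gg']|g h _ _ gh hg].
- by exists (polymap_id k n); split; rewrite polymap_1comp.
- exists (linear_polymap (invmx A)).
  by split; rewrite linear_polymap_comp ?mulmxV ?mulVmx // linear_polymap1.
- exists (elementary_polymap (- P)).
  have Nfree : free_of_first (- P).
    by move=> m; rewrite (perm_mem (msuppN _)); exact: Pfree.
  by split; rewrite elementary_polymap_comp // ?addNr ?subrr elementary_polymap0.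
- exists (polymap_comp g' f'); exact: polymap_inverse_comp.
- by exists g.
Qed.

Lemma mderiv_polyvar (i j : 'I_n) : mderiv j (polyvar k i) = (i == j)%:R.
Proof.
rewrite /polyvar mderivX mnm1E; case: eqVneq => [->|_]; last by rewrite scale0r.
rewrite scale1r; have -> : mnm_sub (mnm1 j) (mnm1 j) = mnm0.
  by apply/mnmP => l; rewrite mnmBE subnn mnm0E.
by rewrite mpolyX0.
Qed.

Lemma mderiv_pullback h P (j : 'I_n) :
  mderiv j (pullback h P) =
  \sum_i pullback h (mderiv i P) * mderiv j (tnth h i).
Proof.
elim/mpoly_subring_ind: P => [||i|c P IH|P Q IP IQ|P Q IP IQ].
- rewrite pullback0 mderiv0 big1 // => i _.
  by rewrite mderiv0 pullback0 mul0r.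
- rewrite pullback1 -mpolyC1 mderivC big1 // => i _.
  by rewrite mderivC pullback0 mul0r.
- rewrite pullback_polyvar (bigD1 i) //= mderiv_polyvar eqxx pullback1 mul1r.
  rewrite big1 ?addr0 // => l li.
  by rewrite mderiv_polyvar eq_sym (negbTE li) pullback0 mul0r.
- rewrite pullbackZ mderivZ IH scaler_sumr; apply: eq_bigr => i _.
  by rewrite mderivZ pullbackZ scalerAl.
- rewrite pullbackD mderivD IP IQ -big_split; apply: eq_bigr => i _ /=.
  by rewrite mderivD pullbackD mulrDl.
- rewrite pullbackM mderivM IP IQ mulr_suml mulr_sumr -big_split.
  apply: eq_bigr => i _ /=.
  by rewrite mderivM pullbackD !pullbackM; ring.
Qed.

(** [mcoeff mnm0] is evaluation at 0, so this is the linear part of h at the origin. *)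
Definition jacobian0 h : 'M[k]_n :=
  \matrix_(i, j) mcoeff mnm0 (mderiv j (tnth h i)).

Lemma jacobian0_unit h g : polymap_inverse h g -> jacobian0 h \in unitmx.
Proof.
move=> hg.
(* Chain rule at 0: J is the Jacobian matrix of g at h(0). *)
pose J : 'M[k]_n :=
  \matrix_(i, j) mcoeff mnm0 (pullback h (mderiv j (tnth g i))).
suff : J *m jacobian0 h = 1%:M by move=> /mulmx1_unit[].
apply/matrixP => i j; rewrite !mxE.
transitivity (mcoeff mnm0 (mderiv j (pullback h (pullback g (polyvar k i))))).
  rewrite mderiv_pullback raddf_sum; apply: eq_bigr => l _ /=.
  by rewrite pullback_polyvar [RHS](rmorphM (mcoeff mnm0)) !mxE.
rewrite (pullbackK _ (polymap_inverse_sym hg)) mderiv_polyvar.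
by rewrite -mpolyC_nat mcoeffC eqxx mulr1.
Qed.

End PolymapAlgebra.

(** * Weighted degrees and equality of valuations *)

Section WeightedDegree.
Variables (R : realType) (k : fieldType) (n : nat).
Implicit Types (a b : 'rV[R]_n) (f g h : polymap k n) (P Q : mpoly n k) (r t : R).

Definition mnm_weight a (m : multinom n) : R := \sum_i a 0 i * (m i)%:R.

(** The weighted degree is the opposite of the valuation [nu_id a]; bounding it monomial by monomial
    covers the zero polynomial, of valuation [+oo]. *)
Definition wdeg_le a r P : Prop := forall m, m \in msupp P -> mnm_weight a m <= r.

Lemma mnm_weightD a m1 m2 :
  mnm_weight a (mnm_add m1 m2) = mnm_weight a m1 + mnm_weight a m2.
Proof.
by rewrite -big_split; apply: eq_bigr => i _ /=; rewrite mnmDE natrD mulrDr.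
Qed.

Lemma mnm_weight0 a : mnm_weight a mnm0 = 0.
Proof. by apply: big1 => i _; rewrite mnm0E mulr0. Qed.

Lemma mnm_weight1 a i : mnm_weight a (mnm1 i) = a 0 i.
Proof.
rewrite /mnm_weight (bigD1 i) //= mnm1E eqxx mulr1 big1 ?addr0 // => j ji.
by rewrite mnm1E eq_sym (negbTE ji) mulr0.
Qed.

Lemma mnm_weightZ t a m : mnm_weight (t *: a) m = t * mnm_weight a m.
Proof. by rewrite mulr_sumr; apply: eq_bigr => i _; rewrite mxE mulrA. Qed.

Lemma wdeg_le_polyvar a i : wdeg_le a (a 0 i) (polyvar k i).
Proof. by move=> m; rewrite msuppX inE => /eqP ->; rewrite mnm_weight1. Qed.

Lemma wdeg_leZ a r c P : wdeg_le a r P -> wdeg_le a r (c *: P).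
Proof. by move=> aP m /msuppZ_le; exact: aP. Qed.

Lemma wdeg_leM a r s P Q :
  wdeg_le a r P -> wdeg_le a s Q -> wdeg_le a (r + s) (P * Q).
Proof.
move=> aP aQ m /msuppM_le /allpairsP[[m1 m2] /= [m1P m2Q ->]].
by rewrite mnm_weightD lerD ?aP ?aQ.
Qed.

Lemma wdeg_le_sum a r (I : eqType) (s : seq I) (F : I -> mpoly n k) :
  (forall i, i \in s -> wdeg_le a r (F i)) -> wdeg_le a r (\sum_(i <- s) F i).
Proof.
move=> aF; rewrite big_seq; elim/big_ind: _ => //.
- by move=> m; rewrite msupp0.
- by move=> P Q aP aQ m /msuppD_le; rewrite mem_cat => /orP[/aP|/aQ].
Qed.

(** By multiplicativity, pulling back by such an h raises no a-degree. An invertible h fixes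
    [nu_id a] exactly when h and its inverse both satisfy this. *)
Definition stabilizes a h := forall i, wdeg_le a (a 0 i) (tnth h i).

Lemma wdeg_le_monomial a h : stabilizes a h ->
  forall m, wdeg_le a (mnm_weight a m) (pullback h (mpolyX k m)).
Proof.
move=> ah m; rewrite /pullback comp_mpolyX /mnm_weight.
elim/big_rec2: _ => [m' | i P r _ aP].
  by rewrite -mpolyC1 msuppC oner_eq0 inE => /eqP ->; rewrite mnm_weight0.
apply: wdeg_leM => //; elim: (m i) => [|e IH].
  move=> m'; rewrite expr0 -mpolyC1 msuppC oner_eq0 inE => /eqP ->.
  by rewrite mnm_weight0 mulr0.
by rewrite exprS -natr1 mulrDr mulr1 addrC; exact: wdeg_leM.
Qed.

Lemma wdeg_le_pullback a h : stabilizes a h ->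
  forall r P, wdeg_le a r P -> wdeg_le a r (pullback h P).
Proof.
move=> ah r P aP; rewrite /pullback comp_mpolyEX; apply: wdeg_le_sum => m mP.
apply: wdeg_leZ => m' m'P; apply: le_trans (aP m mP).
exact: (wdeg_le_monomial ah m'P).
Qed.

Lemma nu_id_geP a r P : (r%:E <= nu_id a P)%E <-> wdeg_le a (- r) P.
Proof.
rewrite /nu_id; split=> [rP m mP|aP].
  rewrite lerNr -lee_fin; apply: le_trans rP _; exact: ge_bigmin_seq.
rewrite big_seq; apply: le_bigmin => [|m mP]; first exact: leey.
by rewrite lee_fin lerNr; exact: aP.
Qed.

Lemma eq_ereal_ge (u v : \bar R) :
  (forall r, (r%:E <= u)%E <-> (r%:E <= v)%E) -> u = v.
Proof.
suff H (x y : \bar R) : (forall r, (r%:E <= x)%E -> (r%:E <= y)%E) -> (x <= y)%E.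
  by move=> uv; apply/eqP; rewrite eq_le !H // => r /uv.
move=> xy; case: x xy => [r||] xy; first exact: xy.
  case: y xy => [s||] xy //; last by have := xy 0 (leey _).
  by have := xy (s + 1) (leey _); rewrite lee_fin gerDl ler10.
exact: leNye.
Qed.

Lemma eq_nu_idP a b P Q : nu_id a P = nu_id b Q <->
  forall r, wdeg_le a r P <-> wdeg_le b r Q.
Proof.
split=> [eqPQ r|eqPQ]; first by rewrite -(opprK r) -!nu_id_geP eqPQ.
by apply: eq_ereal_ge => r; rewrite !nu_id_geP.
Qed.

Lemma nu_idZ a t P : 0 < t -> nu_id (t *: a) P = (t%:E * nu_id a P)%E.
Proof.
move=> t0; apply: eq_ereal_ge => r.
rewrite -lee_pdivrMl // nu_id_geP -EFinM nu_id_geP.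
split=> aP m mP; have := aP m mP; rewrite mnm_weightZ.
  by rewrite -ler_pdivlMl // mulrN.
by rewrite -mulrN ler_pdivlMl.
Qed.

(** [nu_id] is homogeneous in the weight, so the scaling factor can be absorbed into b. *)
Lemma nu_classP f g a b : nu_class f a = nu_class g b ->
  exists2 t, 0 < t & forall P, nu f a P = nu g (t *: b) P.
Proof.
move=> fagb; have : nu_class f a (nu f a).
  by exists 1 => // P; rewrite mul1e.
rewrite fagb => -[t t0 fP]; exists t => // P; rewrite fP.
by rewrite /nu nu_idZ.
Qed.

(** Evaluate both valuations at the component f'_i: f pulls it back to the variable x_i, and g to
    the i-th component of f' o g. *)
Lemma eq_nu_stabilizes f f' g g' a :
  polymap_inverse f f' -> polymap_inverse g g' ->
  (forall P, nu f a P = nu g a P) -> stabilizes a (polymap_comp f' g).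
Proof.
move=> ff' gg' fg i; rewrite tnth_mktuple.
have := fg (tnth f' i); rewrite -pullback_polyvar {1}/nu.
rewrite (pullbackK _ (polymap_inverse_sym ff')) => /eq_nu_idP/(_ (a 0 i))[H _].
exact/H/wdeg_le_polyvar.
Qed.

Lemma stabilizes_eq_nu f f' g g' a :
  polymap_inverse f f' -> polymap_inverse g g' ->
  stabilizes a (polymap_comp f' g) -> stabilizes a (polymap_comp g' f) ->
  nu f a = nu g a.
Proof.
move=> ff' gg' sfg sgf; apply/funext => P; apply/eq_nu_idP => r; split.
  move=> /(wdeg_le_pullback sfg).
  by rewrite -pullback_comp (pullbackK _ ff').
move=> /(wdeg_le_pullback sgf).
by rewrite -pullback_comp (pullbackK _ gg').
Qed.

(** Some term of the Leibniz expansion of the determinant is nonzero. *)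
Lemma unitmx_perm_neq0 (A : 'M[k]_n) :
  A \in unitmx -> exists s : 'S_n, forall i, A i (s i) != 0.
Proof.
rewrite unitmxE unitfE => detA; apply: contrapT => noperm; move/eqP: detA; apply.
rewrite /determinant big1 // => s _.
have [i /negP/negPn/eqP Ai0] : exists i, ~ (A i (s i) != 0).
  by apply: contrapT => H; apply: noperm; exists s => i; apply: contrapT => ?; apply: H; exists i.
by rewrite (bigD1 i) //= Ai0 mul0r mulr0.
Qed.

(** Otherwise s would inject the indices at least i into those greater than i. *)
Lemma perm_le_crossing (s : 'S_n) (i : 'I_n) :
  exists j : 'I_n, (i <= j)%N /\ (s j <= i)%N.
Proof.
apply: contrapT => H.
pose A := [set j : 'I_n | (i <= j)%N]%SET; pose B := [set j : 'I_n | (i < j)%N]%SET.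
have sAB : (s @: A \subset B)%SET.
  apply/fintype.subsetP => x /imsetP[j]; rewrite inE => ij ->; rewrite inE ltnNge.
  by apply/negP => sji; apply: H; exists j.
have : (#|A| <= #|B|)%N by rewrite -(card_imset A (@perm_inj _ s)) subset_leq_card.
rewrite leqNgt => /negP; apply; apply: proper_card; apply/properP; split.
  by apply/fintype.subsetP => j; rewrite !inE => /ltnW.
by exists i; rewrite !inE // ltnn.
Qed.

(* An invertible h has an invertible linear part at 0, so some permutation s makes
   x_(s i) occur linearly in each h_i; this compares the sorted weights. *)
Lemma weight_le_of_pullback a b h h' : polymap_inverse h h' ->
  weight_chamber a -> weight_chamber b ->
  (forall i, wdeg_le b (a 0 i) (tnth h i)) -> forall i, b 0 i <= a 0 i.
Proof.
move=> hh' [_ a_mono] [_ b_mono] bh i.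
have [s sJ] := unitmx_perm_neq0 (jacobian0_unit hh').
have [j [ij sji]] := perm_le_crossing s i.
apply: le_trans (a_mono _ _ ij); apply: le_trans (b_mono _ _ sji) _.
rewrite -mnm_weight1; apply: bh; rewrite mcoeff_msupp.
(* The Jacobian entry at (j, s j) is the coefficient of x_(s j) in h_j. *)
have := sJ j; rewrite mxE mcoeff_mderiv mnm0E mulr1n; apply: contraNneq => /eqP.
by have -> : mnm_add mnm0 (mnm1 (s j)) = mnm1 (s j) by apply/mnmP => l; rewrite mnmDE mnm0E.
Qed.

Lemma weight_chamberZ t a : 0 < t -> weight_chamber a -> weight_chamber (t *: a).
Proof.
move=> t0 [a0 a_mono]; split=> [i|i j ij]; rewrite !mxE.
  by rewrite mulr_gt0 //; exact: a0.
by rewrite ler_pM2l // a_mono.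
Qed.

(** Pulled back by f' o g, x_i has b-degree at most a_i, so [weight_le_of_pullback] gives b <= a;
    exchanging the roles gives a <= b. This makes the retraction well defined. *)
Lemma eq_nu_weight f f' g g' a b :
  polymap_inverse f f' -> polymap_inverse g g' ->
  weight_chamber a -> weight_chamber b ->
  (forall P, nu f a P = nu g b P) -> a = b.
Proof.
have le_ab (a1 b1 : 'rV[R]_n) f1 f1' g1 g1' :
    polymap_inverse f1 f1' -> polymap_inverse g1 g1' ->
    weight_chamber a1 -> weight_chamber b1 ->
    (forall P, nu f1 a1 P = nu g1 b1 P) -> forall i, b1 0 i <= a1 0 i.
  move=> ff' gg' ca cb eqnu.
  have hh' := polymap_inverse_comp (polymap_inverse_sym ff') gg'.
  apply: (weight_le_of_pullback hh' ca cb) => i.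
  rewrite tnth_mktuple; have := eqnu (tnth f1' i).
  rewrite -pullback_polyvar {1}/nu (pullbackK _ (polymap_inverse_sym ff')).
  by move=> /eq_nu_idP/(_ (a1 0 i))[H _]; exact/H/wdeg_le_polyvar.
move=> ff' gg' ca cb eqnu; apply/rowP => i; apply/eqP; rewrite eq_le.
by rewrite (le_ab _ _ _ _ _ _ gg' ff') // (le_ab _ _ _ _ _ _ ff' gg').
Qed.

End WeightedDegree.

(** * Logarithmic coordinates of weights *)

Section LogWeight.
Variables (R : realType) (n : nat).
Implicit Types (a b c : 'rV[R]_n) (t : R).

Lemma ln_prod (I : finType) (F : I -> R) : (forall i, 0 < F i) ->
  ln (\prod_i F i) = \sum_i ln (F i).
Proof.
move=> F0; suff [] : 0 < \prod_i F i /\ ln (\prod_i F i) = \sum_i ln (F i) by [].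
apply: (big_ind2 (fun x y => 0 < x /\ ln x = y)) => [|x1 x2 y1 y2|i _].
- by rewrite ltr01 ln1.
- move=> [x10 <-] [y10 <-]; rewrite mulr_gt0 //; split=> //.
  by rewrite lnM // posrE.
- by split.
Qed.

(** Dividing by the geometric mean subtracts the mean of the logarithms. *)
Lemma log_weightE a i : weight_cone a ->
  log_weight a 0 i = ln (a 0 i) - n%:R^-1 * \sum_j ln (a 0 j).
Proof.
move=> a0; have p0 : 0 < \prod_j a 0 j by apply: prodr_gt0 => j _; exact: a0.
rewrite !mxE lnM ?posrE ?invr_gt0 ?powR_gt0 //.
by rewrite lnV ?posrE ?powR_gt0 // ln_powR ln_prod // addrC.
Qed.

Lemma weight_coneZ t a : 0 < t -> weight_cone a -> weight_cone (t *: a).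
Proof. by move=> t0 a0 i; rewrite mxE mulr_gt0 //; exact: a0. Qed.

Lemma sum_log_weight a : weight_cone a -> \sum_i log_weight a 0 i = 0.
Proof.
move=> a0; under eq_bigr do rewrite log_weightE //.
rewrite sumrB sumr_const card_ord -[X in _ - X]mulr_natr mulrAC.
have [n0|n0] := eqVneq n 0%N; last by rewrite mulVf ?pnatr_eq0 // mul1r subrr.
by rewrite !big1 ?mulr0 ?subrr // => j; have := ltn_ord j; rewrite {2}n0.
Qed.

Lemma log_weightZ t a : 0 < t -> weight_cone a -> log_weight (t *: a) = log_weight a.
Proof.
move=> t0 a0; apply/rowP => i; rewrite !log_weightE //; last exact: weight_coneZ.
under eq_bigr do rewrite mxE lnM ?posrE //.
rewrite mxE lnM ?posrE //.
rewrite big_split sumr_const card_ord /= -[ln t *+ n]mulr_natr.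
have n0 : (n%:R : R) != 0 by rewrite pnatr_eq0 -lt0n (leq_ltn_trans _ (ltn_ord i)).
by field.
Qed.

Lemma weight_exp_log a : weight_cone a ->
  exists2 s, 0 < s & forall i, a 0 i = s * expR (log_weight a 0 i).
Proof.
move=> a0; exists (expR (n%:R^-1 * \sum_j ln (a 0 j))); first exact: expR_gt0.
move=> i; rewrite -expRD log_weightE // addrC subrK lnK // posrE; exact: a0.
Qed.

Lemma log_weight_exp b : \sum_i b 0 i = 0 -> log_weight (\row_i expR (b 0 i)) = b.
Proof.
move=> b0; apply/rowP => i; rewrite log_weightE; last first.
  by move=> j; rewrite mxE expR_gt0.
under eq_bigr do rewrite mxE expRK.
by rewrite b0 mulr0 subr0 mxE expRK.
Qed.

Lemma le_weight_dist a b i :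
  `|log_weight a 0 i - log_weight b 0 i| <= weight_dist a b.
Proof.
rewrite -sqrtr_sqr ler_wsqrtr // (bigD1 i) //= lerDl.
by apply: sumr_ge0 => j _; exact: sqr_ge0.
Qed.

Lemma weight_dist_le a b :
  weight_dist a b <= \sum_i `|log_weight a 0 i - log_weight b 0 i|.
Proof.
set S := \sum_i _; have S0 : 0 <= S by apply: sumr_ge0.
(* With x_i the i-th difference, S^2 is the sum of the products |x_i| S, and each |x_i| is at most
   S. *)
rewrite -(ger0_norm S0) -sqrtr_sqr ler_wsqrtr // expr2 {1}/S mulr_suml.
apply: ler_sum => i _; rewrite -[leLHS]ger0_norm ?sqr_ge0 // normrX expr2.
rewrite ler_wpM2l // /S (bigD1 i) //= lerDl.
exact: sumr_ge0.
Qed.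

End LogWeight.

(** * Semicontinuity of the stabilizer in the weight *)

Section StabilizerSemicontinuity.
Variables (R : realType) (k : fieldType) (n : nat).
Implicit Types (a c : 'rV[R]_n).

Lemma finite_positive_gap (T : finType) (v : T -> R) :
  exists2 d, 0 < d & forall t, v t <= d -> v t <= 0.
Proof.
(* The default 1 keeps d positive when no value is positive; d is halved below so that
   [v t <= d / 2] excludes [d <= v t]. *)
pose d := \big[Order.min/1]_(t | 0 < v t) v t.
have d0 : 0 < d by apply: lt_bigmin.
exists (d / 2); first by rewrite divr_gt0.
move=> t vt; rewrite leNgt; apply/negP => vt0.
have : d <= v t by exact: bigmin_le_cond.
by lra.
Qed.

(** A monomial of c-weight at most 2 c_i has bounded exponents, so the ratio of its weight to c_i
    takes finitely many values, and those above 1 stay away from 1. *)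
Lemma weight_gap c : weight_cone c -> exists2 d, 0 < d &
  forall (m : multinom n) i,
    mnm_weight c m <= (1 + d) * c 0 i -> mnm_weight c m <= c 0 i.
Proof.
move=> c0.
pose B := \sum_i \sum_j (2 * c 0 i / c 0 j).
have le_B i j : 2 * c 0 i / c 0 j <= B.
  have pos i' j' : 0 <= 2 * c 0 i' / c 0 j'.
    by rewrite divr_ge0 ?mulr_ge0 ?ltW //; exact: c0.
  rewrite /B (bigD1 i) //= (bigD1 j) //= -addrA lerDl addr_ge0 //.
    exact: sumr_ge0.
  by apply: sumr_ge0 => i' _; exact: sumr_ge0.
pose N := Num.bound B.
pose w (F : {ffun 'I_n -> 'I_N.+1}) := \sum_j c 0 j * (F j)%:R.
pose v (t : {ffun 'I_n -> 'I_N.+1} * 'I_n) := w t.1 / c 0 t.2 - 1.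
have [d d0 gap] := finite_positive_gap v.
(* The minimum with 1 forces (1 + d) c_i <= 2 c_i, which brings m into the finite range. *)
exists (Num.min d 1); first by rewrite lt_min d0 ltr01.
move=> m i le_m.
have ci := c0 i.
have le2 : mnm_weight c m <= 2 * c 0 i.
  by apply: le_trans le_m _; rewrite ler_pM2r // -[2]/(1 + 1) lerD2l ge_min lexx orbT.
have mN j : (m j < N.+1)%N.
  rewrite ltnS -(ler_nat R) ltW //; apply: le_lt_trans (archi_boundP _); last first.
    by apply: le_trans (le_B i i); rewrite divr_ge0 ?mulr_ge0 ?ltW.
  apply: le_trans (le_B i j); rewrite ler_pdivlMr; last exact: c0.
  rewrite mulrC; apply: le_trans le2; rewrite /mnm_weight (bigD1 j) //= lerDl.
  by apply: sumr_ge0 => l _; rewrite mulr_ge0 // ltW //; exact: c0.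
pose F := [ffun j => inord (m j) : 'I_N.+1].
have wF : w F = mnm_weight c m.
  by apply: eq_bigr => j _; rewrite ffunE inordK.
have := gap (F, i); rewrite /v /= wF lerBlDr ler_pdivrMr // => H.
have : mnm_weight c m / c 0 i - 1 <= 0.
  apply: H; apply: le_trans le_m _; rewrite ler_pM2r // addrC lerD2r.
  by rewrite ge_min lexx.
by rewrite subr_le0 ler_pdivrMr // mul1r.
Qed.

(** After rescaling, c <= q a <= (1 + d) c in every coordinate, so a monomial of h_i has c-weight at
    most q a_i <= (1 + d) c_i, and [weight_gap] removes the factor 1 + d. *)
Lemma stabilizes_near c : weight_cone c -> exists2 e, 0 < e &
  forall a, weight_cone a ->
    (forall i, `|log_weight a 0 i - log_weight c 0 i| < e) ->
    forall h : polymap k n, stabilizes a h -> stabilizes c h.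
Proof.
move=> c0; have [d d0 gap] := weight_gap c0.
have d1 : 1 < 1 + d by rewrite ltrDl.
exists (ln (1 + d) / 2); first by rewrite divr_gt0 ?ln_gt0.
move=> a a0 near h ah i m mh; apply: gap.
have [s s0 aE] := weight_exp_log a0; have [t t0 cE] := weight_exp_log c0.
set e := ln (1 + d) / 2 in near.
(* [t / s] matches the scales of a and c; one factor [expR e] gives c <= q a, a second one q a <= (1
   + d) c, since [expR (e + e)] is 1 + d. *)
pose q := t / s * expR e.
have q0 : 0 < q by rewrite mulr_gt0 ?expR_gt0 ?divr_gt0.
have cq j : c 0 j <= q * a 0 j.
  rewrite aE cE /q mulrACA divfK ?gt_eqF // -expRD ler_pM2l // ler_expR.
  by have := near j; rewrite ltr_norml => /andP[? ?]; lra.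
have qc : q * a 0 i <= (1 + d) * c 0 i.
  have -> : 1 + d = expR (e + e) by rewrite -splitr lnK // posrE; lra.
  rewrite aE cE /q mulrACA divfK ?gt_eqF // [leRHS]mulrCA -!expRD ler_pM2l // ler_expR.
  by have := near i; rewrite ltr_norml => /andP[? ?]; lra.
apply: le_trans qc; apply: (@le_trans _ _ (q * mnm_weight a m)).
  rewrite -mnm_weightZ; apply: ler_sum => j _; rewrite mxE.
  by rewrite ler_wpM2r.
by rewrite ler_pM2l //; exact: ah.
Qed.

End StabilizerSemicontinuity.

(** * Chambers, the retraction and chains *)

Section Chambers.
Variables (R : realType) (k : fieldType) (n : nat).
Implicit Types (x y z : tame_space R k n) (f g : polymap k n) (a b c : 'rV[R]_n).

Definition in_chamber x f a :=
  [/\ tame f, weight_chamber a & val x = nu_class f a].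

(** After rescaling b the two valuations agree, so [eq_nu_weight] identifies the weights; f' o g and
    g' o f then stabilize a, hence c. *)
Lemma in_chamber_unique x f g a b : in_chamber x f a -> in_chamber x g b ->
  log_weight a = log_weight b /\
  forall c, (forall h : polymap k n, stabilizes a h -> stabilizes c h) ->
    nu f c = nu g c.
Proof.
move=> [tf ca xf] [tg cb xg].
have [f' ff'] := tame_inverse tf; have [g' gg'] := tame_inverse tg.
have [t t0 fg] : exists2 t, 0 < t & forall P, nu f a P = nu g (t *: b) P.
  by apply: nu_classP; rewrite -xf -xg.
have ab := eq_nu_weight ff' gg' ca (weight_chamberZ t0 cb) fg.
have {fg} fg P : nu f a P = nu g a P by rewrite fg ab.
split; first by rewrite ab log_weightZ //; case: cb.
move=> c stab; apply: (stabilizes_eq_nu ff' gg'); apply: stab.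
  exact: (eq_nu_stabilizes ff' gg' fg).
by apply: (eq_nu_stabilizes gg' ff') => P; rewrite fg.
Qed.

Definition chamber_point x := exists f a, in_chamber x f a.

(* In logarithmic coordinates; the value at points of no chamber is the junk value 0. *)
Definition retraction x : 'rV[R]_n :=
  xget 0 [set c | exists f a, in_chamber x f a /\ c = log_weight a].

Lemma retractionE x f a : in_chamber x f a -> retraction x = log_weight a.
Proof.
move=> xfa; rewrite /retraction; case: xgetP => [c _ [g [b [xgb ->]]]|].
  by have [] := in_chamber_unique xgb xfa.
by move=> /(_ (log_weight a)); case; exists f, a.
Qed.

Lemma chain_lengths_ind (Q : tame_space R k n -> tame_space R k n -> R -> Prop) :
  (forall x, Q x x 0) ->
  (forall x y z f l L, tame f -> chamber_dist f x y l -> Q y z L -> Q x z (l + L)) ->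
  forall x y L, chain_lengths x y L -> Q x y L.
Proof.
move=> Q0 QS x y L [m [u [f [l [u0 um H ->]]]]].
elim: m u f l x u0 um H => [|m IH] u f l x u0 um H.
  by rewrite big_ord0 -um u0.
rewrite big_ord_recl; have [tf0 df0] := H 0%N isT.
rewrite u0 in df0; apply: QS tf0 df0 _.
apply: (IH (u \o S) (f \o S) (l \o S)) => // i im; exact: H.
Qed.

Lemma chamber_distP f x y l : tame f -> chamber_dist f x y l ->
  exists a b, [/\ in_chamber x f a, in_chamber y f b & l = weight_dist a b].
Proof. by move=> tf [a [b [ca cb xa yb ->]]]; exists a, b. Qed.

(** Inside one chamber the retraction reads off logarithmic coordinates, whose differences are at
    most the Euclidean distance. *)
Lemma retraction_lipschitz x y L : chain_lengths x y L ->
  forall i, `|retraction x 0 i - retraction y 0 i| <= L.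
Proof.
move: x y L; apply: chain_lengths_ind => [x i|x y z f l L tf xy IH i].
  by rewrite subrr normr0.
have [a [b [xa yb ->]]] := chamber_distP tf xy.
apply: le_trans (ler_distD (retraction y 0 i) _ _) _; apply: lerD => //.
rewrite (retractionE xa) (retractionE yb); exact: le_weight_dist.
Qed.

Lemma chain_lengths_chamber_point x y L : chain_lengths x y L ->
  x = y \/ chamber_point x.
Proof.
move: x y L; apply: chain_lengths_ind => [x|x y z f l L tf xy _]; first by left.
by right; have [a [b [xa _ _]]] := chamber_distP tf xy; exists f, a.
Qed.

(* Along a chain whose retraction stays near [c], consecutive chambers differ by an
   element of the stabilizer of a weight near [c], hence of [c]. *)
Lemma chain_lengths_same_fiber c e :
  (forall a, weight_cone a ->
    (forall i, `|log_weight a 0 i - log_weight c 0 i| < e) ->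
    forall h : polymap k n, stabilizes a h -> stabilizes c h) ->
  forall x y L, chain_lengths x y L ->
  forall f a, in_chamber x f a ->
    (forall i, `|retraction x 0 i - log_weight c 0 i| + L < e) ->
    exists g b, in_chamber y g b /\ nu f c = nu g c.
Proof.
move=> stab x y L xyL.
(* [0 <= L] joins the induction so that the bound on retraction plus length also bounds the
   retraction alone. *)
suff [] : 0 <= L /\ (forall f a, in_chamber x f a ->
    (forall i, `|retraction x 0 i - log_weight c 0 i| + L < e) ->
    exists g b, in_chamber y g b /\ nu f c = nu g c) by [].
move: x y L xyL; apply: chain_lengths_ind => [x|x y z f l L tf xy [L0 IH]].
  by split=> // f a xa _; exists f, a.
have [a [b [xa yb lE]]] := chamber_distP tf xy.
have l0 : 0 <= l by rewrite lE sqrtr_ge0.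
split=> [|f1 a1 xa1 near]; first exact: addr_ge0.
have [_ fE] := in_chamber_unique xa1 xa.
have ff1 : nu f1 c = nu f c.
  apply: fE; have [_ [ca1 _] _] := xa1; apply: stab => // i.
  rewrite -(retractionE xa1); apply: le_lt_trans (near i).
  by rewrite lerDl addr_ge0.
(* The first link moves the retraction by at most l and shortens the remaining chain by l, so the
   bound passes to y. *)
have [i|g [b' [zb' gE]]] := IH f b yb; last by exists g, b'; rewrite ff1.
apply: le_lt_trans (near i); rewrite addrA lerD2r.
apply: le_trans (ler_distD (retraction x 0 i) _ _) _.
rewrite [leRHS]addrC lerD2r lE distrC (retractionE xa) (retractionE yb).
exact: le_weight_dist.
Qed.

Lemma ball_chain_lengthsP x e y :
  ball x e y <-> exists2 L, chain_lengths x y L & L < e.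
Proof. exact: dX_ballP. Qed.

Lemma nu_class_mem f a : tame f -> weight_cone a ->
  nu_class f a \in @tame_valuation_classes R k n.
Proof. by move=> tf ca; apply/mem_set; exists f, a. Qed.

Definition nu_point f a (tf : tame f) (ca : weight_cone a) : tame_space R k n :=
  SigSub (nu_class_mem tf ca).

(** As [nu f c = nu g c], the point of weight c also lies in the chamber of g, and one link joins it
    to x. *)
Lemma nu_point_ball f c (tf : tame f) (cc : weight_cone c) x g a e :
  weight_chamber c -> in_chamber x g a -> nu f c = nu g c ->
  weight_dist c a < e -> ball (nu_point tf cc) e x.
Proof.
move=> Cc [tg ca xa] fg lt_e; apply/ball_chain_lengthsP; exists (weight_dist c a) => //.
exists 1%N, (fun i => if i is 0%N then nu_point tf cc else x), (fun=> g),
  (fun=> weight_dist c a).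
split=> //; last by rewrite big_ord1.
by case=> // _; split=> //; exists c, a; split=> //=; rewrite /nu_class fg.
Qed.

End Chambers.

(** The denominator n + 1, instead of n, makes the inequality strict. *)
Lemma sum_div_succ_lt (R : realFieldType) n (e : R) :
  0 < e -> \sum_(i < n) e / n.+1%:R < e.
Proof.
move=> e0; rewrite sumr_const card_ord -[_ / _ *+ n]mulr_natr mulrAC.
by rewrite ltr_pdivrMr // ltr_pM2l // ltr_nat.
Qed.

(** * Convergence of Cauchy filters *)

Section Completeness.
Variables (R : realType) (k : fieldType) (n : nat).
Variable F : set_system (tame_space R k n).
Hypothesis FF : ProperFilter F.
Hypothesis cauchyF : cauchy F.

Let cauchy_ballF e : 0 < e -> exists x, F (ball x e).
Proof. by move=> e0; have /cauchyP := cauchyF; exact. Qed.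

(** The retraction is Lipschitz, so it sends F to a Cauchy filter on the complete space of row
    vectors. *)
Lemma cauchy_retraction_cvg : exists b : 'rV[R]_n,
  forall e, 0 < e -> F [set x | forall i, `|retraction x 0 i - b 0 i| < e].
Proof.
have cauchy_im : cauchy ((@retraction R k n) @ F).
  apply: cauchy_exP => e e0; have [x Fx] := cauchy_ballF e0.
  exists (retraction x); apply: (@filterS _ F _ _ _ _ Fx) => y /ball_chain_lengthsP[L xyL Le] /=.
  split=> // i j.
  rewrite /ball /= ord1; exact: le_lt_trans (retraction_lipschitz xyL j) Le.
have /cvg_ex[b bF] : cvg ((@retraction R k n) @ F) by exact: (@cauchy_cvg _ _ _ cauchy_im).
exists b => e e0; have /cvg_ballP/(_ e e0) := bF.
by apply: filterS => x bx i; rewrite distrC; by case: bx => _; exact.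
Qed.

(* Every chain from a point of no chamber is trivial, so such a point would be
   isolated; this spares showing that the chambers cover the space. *)
Lemma isolated_cvg x : F (ball x 1) -> ~ chamber_point x -> F --> x.
Proof.
move=> Fx nx; apply/cvg_ballP => e e0; apply: filterS Fx => y /ball_chain_lengthsP[L xyL _].
have [<-|//] := chain_lengths_chamber_point xyL; exact: ballxx.
Qed.

(** Summing to zero and being nonincreasing are closed conditions, so the limit b inherits them from
    the retractions of chamber points, and its exponential serves as c. *)
Lemma limit_weight_chamber : F (@chamber_point R k n) -> exists c : 'rV[R]_n,
  weight_chamber c /\
  forall e, 0 < e -> F [set x | forall i, `|retraction x 0 i - log_weight c 0 i| < e].
Proof.
move=> Fch; have [b bF] := cauchy_retraction_cvg.
have approx e : 0 < e -> exists a, weight_chamber a /\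
    forall i, `|log_weight a 0 i - b 0 i| < e.
  move=> e0; have [x [[f [a xa]] xb]] := filter_ex (filterI Fch (bF e e0)).
  by exists a; rewrite -(retractionE xa); case: xa.
have sum_b : \sum_i b 0 i = 0.
  apply/eqP; rewrite -normr_le0; apply/ler_addgt0Pl => e e0; rewrite addr0.
  have e'0 : 0 < e / n.+1%:R by rewrite divr_gt0.
  have [a [[ca _] ab]] := approx _ e'0.
  have -> : \sum_i b 0 i = - \sum_i (log_weight a 0 i - b 0 i).
    by rewrite sumrB sum_log_weight // sub0r opprK.
  rewrite normrN.
  apply: le_trans (ler_norm_sum _ _ _) _.
  apply: (@le_trans _ _ (\sum_(i < n) e / n.+1%:R)).
    by apply: ler_sum => i _; exact: ltW.
  exact/ltW/sum_div_succ_lt.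
have b_mono (i j : 'I_n) : (i <= j)%N -> b 0 j <= b 0 i.
  move=> ij; apply/ler_addgt0Pl => e e0.
  have e'0 : 0 < e / 2 by rewrite divr_gt0.
  have [a [[ca a_mono] ab]] := approx _ e'0.
  have : log_weight a 0 j <= log_weight a 0 i.
    by rewrite !log_weightE // lerD2r ler_ln ?posrE ?ca // a_mono.
  have := ab i; have := ab j; rewrite !ltr_norml => /andP[? ?] /andP[? ?] ?.
  by lra.
exists (\row_i expR (b 0 i)); rewrite log_weight_exp //; split=> //; split.
  by move=> i; rewrite mxE expR_gt0.
by move=> i j ij; rewrite !mxE ler_expR b_mono.
Qed.

Lemma cauchy_tame_space_cvg : cvg F.
Proof.
have [x0 Fx0] := cauchy_ballF ltr01.
have [x0ch|] := pselect (chamber_point x0); last first.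
  by move=> /(isolated_cvg Fx0) Fx; apply/cvg_ex; exists x0.
have Fch : F (@chamber_point R k n).
  apply: filterS Fx0 => y /ball_chain_lengthsP[L /chain_lengthsC yxL _].
  by have [->|] := chain_lengths_chamber_point yxL.
have [c [Cc cF]] := limit_weight_chamber Fch.
have cc : weight_cone c by case: Cc.
have [e e0 stab] := stabilizes_near k cc.
(* Budget: e/2 for the retraction of [x1], and e/4 twice for a chain from [x1] to x through [x2];
   the total stays below the e of [chain_lengths_same_fiber]. *)
have e2 : 0 < e / 2 by rewrite divr_gt0.
have e4 : 0 < e / 4 by rewrite divr_gt0.
have [x2 Fx2] := cauchy_ballF e4.
have [x1 [[[f1 [a1 xa1]] x1c] x21]] :=
  filter_ex (filterI (filterI Fch (cF _ e2)) Fx2).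
have [tf1 _ _] := xa1.
(* The limit is the point of weight c in the chamber of [f1]; every x in the ball around [x2] lies
   in some chamber that also contains it. *)
apply/cvg_ex; exists (nu_point tf1 cc); apply/cvg_ballP => d d0.
have d'0 : 0 < d / n.+1%:R by rewrite divr_gt0.
apply: filterS (filterI (cF _ d'0) Fx2) => x [xc x2x].
have /ball_chain_lengthsP[L xL Le] : ball x1 (e / 4 + e / 4) x.
  exact: ball_triangle (ball_sym x21) x2x.
have [i|g [a [xa fg]]] := chain_lengths_same_fiber stab xL xa1.
  by have := x1c i; lra.
apply: (nu_point_ball tf1 cc Cc xa fg).
apply: le_lt_trans (weight_dist_le _ _) _.
apply: (@le_lt_trans _ _ (\sum_(i < n) d / n.+1%:R)).
  by apply: ler_sum => i _; rewrite distrC -(retractionE xa) ltW // xc.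
exact: sum_div_succ_lt.
Qed.

End Completeness.

Theorem mainTheorem5 (R : realType) (k : fieldType) (n : nat) (hn : (1 < n)%N) :
  forall F : set_system (tame_space R k n),
    ProperFilter F -> cauchy F -> cvg F.
Proof. by move=> F FF; exact: cauchy_tame_space_cvg. Qed.
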